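(* Let $(X_1,Y_1),\ldots,(X_{m+1},Y_{m+1})$ be data points, $R(\cdot,\cdot)$ a fixed (pre-trained) non-negative real-valued score function, and $R_i=R(X_i,Y_i)$ for $1\le i\le m+1$. Suppose $R_1,\ldots,R_{m+1}$ are independent continuous random variables and that $R_1,\ldots,R_m$ are identically distributed (the law of $R_{m+1}$ may differ). Let $R_{(1)}\le\cdots\le R_{(m)}$ be the order statistics of $R_1,\ldots,R_m$, let $\alpha\in(0,1)$, and let $\widehat C_{m,\alpha}(X_{m+1})=\{y:R(X_{m+1},y)\le R_{(\lceil(m+1)(1-\alpha)\rceil)}\}$. Then, with $\widetilde F_0(z)=\mathbb P(R_1<z)$ for $z\in\mathbb R$, $$-d_{\mathrm{KS}}(\widetilde F_0(R_{m+1}),U(0,1))\le\mathbb P\big(Y_{m+1}\in\widehat C_{m,\alpha}(X_{m+1})\big)-(1-\alpha)\le\frac1{m+1}+d_{\mathrm{KS}}(\widetilde F_0(R_{m+1}),U(0,1)).$$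
   Context: $d_{\mathrm{KS}}(Y_1,Y_2)=\sup_{t\in\mathbb R}|\mathbb P(Y_1\le t)-\mathbb P(Y_2\le t)|$ is the Kolmogorov–Smirnov distance between the laws of real random variables; $U(0,1)$ is a standard uniform random variable. A continuous random variable is one with a continuous distribution function. Convention: $R_{(m+1)}=+\infty$. *)

(* Defs.v *)
From HB Require Import structures.
From mathcomp Require Import all_boot all_order all_algebra.
From mathcomp Require Import all_classical all_reals all_analysis.
From mathcomp Require Import measurable_realfun.

Set Implicit Arguments.
Unset Strict Implicit.
Unset Printing Implicit Defensive.

Import Order.TTheory GRing.Theory Num.Theory.
Import numFieldNormedType.Exports.

Local Open Scope classical_set_scope.
Local Open Scope ring_scope.

Definition mutually_independent (d : measure_display) (T : measurableType d)
    (R : realType) (P : probability T R) (I : finType)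
    (S : I -> {RV P >-> R}) : Prop :=
  forall (J : {set I}) (B : I -> set R), (forall i, measurable (B i)) ->
    P (\bigcap_(i in [set i | i \in J]) S i @^-1` B i) =
    (\prod_(i in J) P (S i @^-1` B i))%E.

(* The laws are compared on measurable sets only: in the library a measure is a
   function on all sets, with no meaning outside the sigma-algebra. *)
Definition same_law (d : measure_display) (T : measurableType d)
    (R : realType) (P : probability T R) (S1 S2 : {RV P >-> R}) : Prop :=
  forall A : set R, measurable A -> distribution P S1 A = distribution P S2 A.

(* Continuity of the distribution function, not existence of a density. *)
Definition continuous_rv (d : measure_display) (T : measurableType d)
    (R : realType) (P : probability T R) (S : {RV P >-> R}) : Prop :=
  continuous (cdf S).

(* [mu] and [nu] are the laws of the two random variables, i.e., probability
   measures on the line. They are taken as bare set functions because the library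
   equips R with its Borel sigma-algebra under two displays: [distribution] uses
   one and [uniform_prob] the other. For laws, the supremum is over a nonempty
   subset of [0, 1], so the real-valued [sup] is the genuine least upper bound. *)
Definition dKS (R : realType) (mu nu : set R -> \bar R) : R :=
  sup (range (fun t : R =>
    `|fine (mu `]-oo, t]%classic) - fine (nu `]-oo, t]%classic)|)).

Section strict_cdf.
Context (d : measure_display) (T : measurableType d) (R : realType)
  (P : probability T R).

Definition strict_cdf (S : {RV P >-> R}) (z : R) : R :=
  fine (P [set w | S w < z]).

Lemma measurable_strict_cdf (S : {RV P >-> R}) :
  measurable_fun [set: R] (strict_cdf S).
Proof.
have mS z : measurable [set w | S w < z].
  rewrite (_ : [set w | S w < z] = S @^-1` `]-oo, z[).
    exact: measurable_funPTI.
  by apply/seteqP; split=> w /=; rewrite in_itv.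
apply: nondecreasing_measurable => //= z1 z2 z12.
rewrite /strict_cdf fine_le ?fin_num_measure//.
by apply: le_measure; rewrite ?inE// => w /= /lt_le_trans; apply.
Qed.

HB.instance Definition _ (S : {RV P >-> R}) :=
  isMeasurableFun.Build _ _ R R (strict_cdf S) (measurable_strict_cdf S).

End strict_cdf.

(* The [k]-th smallest element of [r], counted from 1, with value +oo beyond
   [size r]; the index k = 0 is not meaningful. *)
Definition order_stat (R : realType) (r : seq R) (k : nat) : \bar R :=
  nth +oo%E [seq x%:E | x <- sort <=%R r] k.-1.

Definition conformal_rank (R : realType) (m : nat) (alpha : R) : nat :=
  `|Num.ceil (m.+1%:R * (1 - alpha))|%N.

(* [r] is the list of the calibration scores. *)
Definition conformal_set (R : realType) (XT YT : Type) (score : XT -> YT -> R)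
    (r : seq R) (alpha : R) (x : XT) : set YT :=
  [set y | ((score x y)%:E <=
            order_stat r (conformal_rank (size r) alpha))%E].

(* Main.v *)
(* With k the conformal rank, coverage means that fewer than k calibration scores
   lie strictly below R_{m+1}. Put V = F0(R_{m+1}), where F0 is the continuous
   distribution function of R_1. Since the F0(R_i) are independent and uniform,
   coverage has probability E[G(V)], where G(u) = P(Bin(m, u) < k) decreases from
   1 to 0. If the distribution function of V is within D of that of U(0, 1),
   integration by parts gives |E[G(V)] - int_0^1 G| <= D, and
   int_0^1 G = k / (m + 1).

   Both integrals are replaced by sums over a grid of mesh 1 / N: on the slice
   j / N < V <= (j + 1) / N the coverage event is squeezed between the events
   that fewer than k of the F0(R_i) are at most (j + 1) / N, resp. j / N, which
   are independent of V. This avoids Fubini and the joint law of the scores;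
   letting N go to infinity finishes the proof. The rank k = m + 1 is apart, as
   then G = 1 and coverage is certain. *)

Require Import Defs.
From mathcomp Require Import all_boot all_order all_algebra.
From mathcomp Require Import all_classical all_reals all_analysis.
From mathcomp Require Import measurable_realfun ring lra.

Set Implicit Arguments.
Unset Strict Implicit.
Unset Printing Implicit Defensive.

Import Order.TTheory GRing.Theory Num.Theory.
Import numFieldNormedType.Exports.

Local Open Scope classical_set_scope.
Local Open Scope ring_scope.

(** * Bernstein polynomials and the binomial distribution function *)

Section binomial_tail.
Variable R : realType.
Implicit Types (n k : nat) (u x y : R).

(** For j > n the truncated exponent n - j is 0, but the binomial coefficient vanishes and so does
    the polynomial. *)
Definition bernstein n j : {poly R} :=
  ('X^j * (1 - 'X) ^+ (n - j)) *+ 'C(n, j).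

(* At u, the probability that a binomial(n, u) variable is less than k. *)
Definition binomial_tail n k : {poly R} := \sum_(j < k) bernstein n j.

Let deriv_1subX : (1 - 'X)^`() = -1 :> {poly R}.
Proof. by rewrite derivB derivX -[1]/(1%:P) derivC sub0r. Qed.

Lemma deriv_bernstein n j :
  (bernstein n.+1 j.+1)^`() = (bernstein n j - bernstein n j.+1) *+ n.+1.
Proof.
rewrite /bernstein derivMn derivM derivXn subSS deriv_exp.
rewrite deriv_1subX -subnS.
have e1 : (j.+1 * 'C(n.+1, j.+1) = n.+1 * 'C(n, j))%N by rewrite mul_bin_diag.
have e2 : ((n - j) * 'C(n.+1, j.+1) = n.+1 * 'C(n, j.+1))%N.
  by rewrite (mul_bin_down n.+1 j.+1) subSS.
rewrite mulN1r mulrnAl mulrnAr mulrN /= !mulrnDl !mulNrn -!mulrnA e1 e2.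
by rewrite ![('C(_, _) * _)%N]mulnC.
Qed.

Lemma deriv_bernstein0 n : (bernstein n.+1 0)^`() = - bernstein n 0 *+ n.+1.
Proof.
rewrite /bernstein !bin0 !mulr1n !expr0 !mul1r deriv_exp !subn0.
by rewrite deriv_1subX mulN1r.
Qed.

(** Differentiation makes the sum telescope, and only the last Bernstein term survives. *)
Lemma deriv_binomial_tail n k :
  (binomial_tail n.+1 k.+1)^`() = - bernstein n k *+ n.+1.
Proof.
elim: k => [|k IH].
  by rewrite /binomial_tail big_ord1 deriv_bernstein0.
rewrite /binomial_tail big_ord_recr derivD [X in X + _]IH deriv_bernstein.
by rewrite -mulrnDl addKr.
Qed.

Lemma bernstein_ge0 n j u : 0 <= u <= 1 -> 0 <= (bernstein n j).[u].
Proof.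
move=> /andP[u0 u1]; rewrite hornerMn hornerM !hornerE.
by rewrite mulrn_wge0 // mulr_ge0 ?exprn_ge0 ?subr_ge0.
Qed.

Lemma bernstein_0 n j : (bernstein n j).[0] = (j == 0)%:R.
Proof.
rewrite hornerMn hornerM !hornerE subr0 expr1n mulr1 expr0n.
by case: j => [|j]; rewrite /= ?bin0 // mul0rn.
Qed.

Lemma bernstein_1 n j : (j < n)%N -> (bernstein n j).[1] = 0.
Proof.
move=> jn; rewrite hornerMn hornerM !hornerE subrr expr0n.
by rewrite subn_eq0 leqNgt jn mulr0 mul0rn.
Qed.

Lemma binomial_tail_0 n k : (binomial_tail n k.+1).[0] = 1.
Proof.
rewrite /binomial_tail horner_sum big_ord_recl bernstein_0 big1 ?addr0 // => i _.
by rewrite bernstein_0.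
Qed.

Lemma binomial_tail_1 n k : (k <= n)%N -> (binomial_tail n k).[1] = 0.
Proof.
move=> kn; rewrite /binomial_tail horner_sum big1 // => i _.
by rewrite bernstein_1 // (leq_trans _ kn).
Qed.

(** This is n + 1 times the integral of [binomial_tail n k] from 0: summand i is n + 1 times the
    integral of [bernstein n i]. *)
Definition binomial_tail_primitive n k : {poly R} :=
  \sum_(i < k) (1 - binomial_tail n.+1 i.+1).

Lemma deriv_binomial_tail_primitive n k :
  (binomial_tail_primitive n k)^`() = binomial_tail n k *+ n.+1.
Proof.
rewrite /binomial_tail_primitive raddf_sum -sumrMnl; apply: eq_bigr => i _ /=.
by rewrite derivB deriv_binomial_tail -[1]/(1%:P) derivC sub0r mulNrn opprK.
Qed.

Lemma binomial_tail_primitive_0 n k : (binomial_tail_primitive n k).[0] = 0.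
Proof.
rewrite horner_sum big1 // => i _.
by rewrite !hornerE binomial_tail_0 subrr.
Qed.

(** Every summand is 1 at 1. Hence [binomial_tail n k] has integral k / (n + 1) over [0, 1]. *)
Lemma binomial_tail_primitive_1 n k : (k <= n.+1)%N ->
  (binomial_tail_primitive n k).[1] = k%:R.
Proof.
move=> kn; rewrite horner_sum (eq_bigr (fun=> 1)); last first.
  by move=> i _; rewrite !hornerE binomial_tail_1 ?subr0 // (leq_trans _ kn).
by rewrite sumr_const card_ord.
Qed.

Lemma poly_MVT (p : {poly R}) x y : x <= y ->
  exists2 c, x <= c <= y & p.[y] - p.[x] = p^`().[c] * (y - x).
Proof.
move=> xy; have [c] := @MVT_segment R (horner p) (horner p^`()) x y xy
  (fun z _ => is_derive_poly p z) (continuous_subspaceT (@continuous_horner R p)).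
by rewrite in_itv /= => cxy ->; exists c.
Qed.

Lemma binomial_tail_nonincreasing n k x y : (0 < k)%N -> 0 <= x -> x <= y ->
  y <= 1 -> (binomial_tail n.+1 k).[y] <= (binomial_tail n.+1 k).[x].
Proof.
case: k => // k _ x0 xy y1; rewrite -subr_le0.
have [c /andP[xc cy] ->] := poly_MVT (binomial_tail n.+1 k.+1) xy.
rewrite deriv_binomial_tail hornerMn hornerN mulr_le0_ge0 ?subr_ge0 //.
rewrite mulNrn oppr_le0 mulrn_wge0 // bernstein_ge0 //.
by rewrite (le_trans x0 xc) (le_trans cy y1).
Qed.

(** By the mean value theorem the increment is (n + 2)(y - x) times a value of the decreasing tail
    between x and y. *)
Lemma binomial_tail_primitive_increment n k x y : (0 < k)%N -> 0 <= x ->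
  x <= y -> y <= 1 ->
  (binomial_tail n.+1 k).[y] * (y - x) * n.+2%:R <=
    (binomial_tail_primitive n.+1 k).[y] - (binomial_tail_primitive n.+1 k).[x] <=
  (binomial_tail n.+1 k).[x] * (y - x) * n.+2%:R.
Proof.
move=> k0 x0 xy y1.
have [c /andP[xc cy] ->] := poly_MVT (binomial_tail_primitive n.+1 k) xy.
rewrite deriv_binomial_tail_primitive hornerMn mulrnAl !mulr_natr !lerMn2r /=.
by rewrite !ler_wpM2r ?subr_ge0 ?binomial_tail_nonincreasing //
  ?(le_trans x0 xc) ?(le_trans cy y1).
Qed.

End binomial_tail.

(** The entries below x come first in the sorted list. Past its end both sides hold: the value is
    +oo, and the count is at most the size, which is less than k. *)
Lemma order_statE (R : realType) (r : seq R) (k : nat) (x : R) : (0 < k)%N ->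
  (x%:E <= order_stat r k)%E = (count (< x)%R r < k)%N.
Proof.
case: k => // k _; rewrite /order_stat /=.
have [kr|rk] := ltnP k (size r); last first.
  rewrite nth_default ?size_map ?size_sort// leey ltnS.
  by rewrite (leq_trans (count_size _ _)).
rewrite (nth_map 0) ?size_sort// lee_fin -(count_sort <=%R) ltnS.
have srt : sorted <=%R (sort <=%R r) by apply: sort_sorted; exact: le_total.
have [cr|rc] := leqP (count _ _) k.
  by rewrite nth_count_ge // cr size_sort.
by apply/negbTE; rewrite -ltNge nth_count_lt.
Qed.

(** * Summation by parts and Riemann sums on a grid *)

Section step_sums.
Variable R : realFieldType.
Implicit Types (a g e : nat -> R) (D : R).

(** The two forms of summation by parts sample g at the left or right end of each slice; they serve
    the upper and the lower bound respectively. *)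
Lemma Abel_sum_left a g n :
  \sum_(j < n) (a j.+1 - a j) * g j + a 0%N * g 0%N =
  \sum_(j < n) a j.+1 * (g j - g j.+1) + a n * g n.
Proof.
elim: n => [|n IH]; first by rewrite !big_ord0.
by rewrite !big_ord_recr /= addrAC IH; ring.
Qed.

Lemma Abel_sum_right a g n :
  \sum_(j < n) (a j.+1 - a j) * g j.+1 + a 0%N * g 0%N =
  \sum_(j < n) a j * (g j - g j.+1) + a n * g n.
Proof.
elim: n => [|n IH]; first by rewrite !big_ord0.
by rewrite !big_ord_recr /= addrAC IH; ring.
Qed.

Lemma sum_bounded_decrements e g D n :
  (forall j, (j < n)%N -> `|e j| <= D) ->
  (forall j, (j < n)%N -> g j.+1 <= g j) ->
  `|\sum_(j < n) e j * (g j - g j.+1)| <= D * (g 0%N - g n).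
Proof.
move=> eD gd; elim: n eD gd => [|n IH] eD gd.
  by rewrite big_ord0 normr0 subrr mulr0.
rewrite big_ord_recr /= (le_trans (ler_normD _ _)) //.
have -> : D * (g 0%N - g n.+1) = D * (g 0%N - g n) + D * (g n - g n.+1) by ring.
rewrite lerD ?IH // => [j jn|j jn|]; [exact: eD (ltnW _)|exact: gd (ltnW _)|].
by rewrite normrM ler_pM // ?eD // ger0_norm // subr_ge0 gd.
Qed.

(* Discrete form of |E g(V) - c| <= D, where c is the integral of a decreasing g
   over [0, 1] and V is D-close to uniform: [a] samples the distribution function
   of V on the grid j / N, and summation by parts moves the differences onto g,
   whose total variation is 1. *)
Lemma step_sums_bounds a g D c N : (0 < N)%N ->
  (forall j, (j <= N)%N -> `|a j - j%:R / N%:R| <= D) ->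
  (forall j, (j < N)%N -> g j.+1 <= g j) -> g 0%N = 1 -> g N = 0 ->
  \sum_(j < N) g j.+1 <= N%:R * c <= \sum_(j < N) g j ->
  \sum_(j < N) (a j.+1 - a j) * g j + a 0%N <= c + D + N%:R^-1 /\
  c - D - N%:R^-1 <= \sum_(j < N) (a j.+1 - a j) * g j.+1 + a 0%N.
Proof.
move=> N0 aD gd g0 gN /andP[cl cu]; pose e j := a j - j%:R / N%:R.
have Npos : 0 < N%:R :> R by rewrite ltr0n.
(* The left and right Riemann sums differ by g 0 - g N = 1, which is the source of the error 1 /
   N. *)
have shift : \sum_(j < N) g j = \sum_(j < N) g j.+1 + 1.
  have := telescope_sumr g (leq0n N); rewrite big_mkord g0 gN sumrB; lra.
(* Writing a j = e j + j / N separates the deviation from uniformity, at most D, from a Riemann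
   sum. *)
have decomp (f : nat -> R) : \sum_(j < N) (a j.+1 - a j) * f j =
    \sum_(j < N) (e j.+1 - e j) * f j + N%:R^-1 * \sum_(j < N) f j.
  rewrite mulr_sumr -big_split; apply: eq_bigr => j _ /=.
  by rewrite /e -natr1; ring.
have e0 : a 0%N = e 0%N * g 0%N by rewrite /e g0 mulr1 mul0r subr0.
split.
- rewrite decomp addrAC e0 Abel_sum_left gN mulr0 addr0.
  have := @sum_bounded_decrements (fun j => e j.+1) g D N (fun j jN => aD j.+1 jN) gd.
  rewrite g0 gN subr0 mulr1 => /ler_normlP[_ eD].
  have : N%:R^-1 * \sum_(j < N) g j <= c + N%:R^-1.
    by rewrite shift mulrDr mulr1 lerD2r mulrC ler_pdivrMr // mulrC.
  lra.
- rewrite (decomp (fun j => g j.+1)) [leRHS]addrAC e0 (Abel_sum_right e g) gN mulr0 addr0.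
  have := @sum_bounded_decrements e g D N (fun j jN => aD j (ltnW jN)) gd.
  rewrite g0 gN subr0 mulr1 => /ler_normlP[eD _].
  have : c - N%:R^-1 <= N%:R^-1 * \sum_(j < N) g j.+1.
    rewrite lerBlDr -[X in _ + X]mulr1 -mulrDr -shift [_ * (\sum_(_ < _) _)]mulrC.
    by rewrite ler_pdivlMr // mulrC.
  lra.
Qed.

End step_sums.

(** The middle term is N times the integral of the tail, and a decreasing function has its integral
    between its right and left Riemann sums. *)
Lemma binomial_tail_Riemann_sums (R : realType) n k N : (0 < N)%N ->
  (0 < k <= n.+1)%N ->
  \sum_(j < N) (binomial_tail R n.+1 k).[j.+1%:R / N%:R] <=
    N%:R * (k%:R / n.+2%:R) <=
  \sum_(j < N) (binomial_tail R n.+1 k).[j%:R / N%:R].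
Proof.
move=> N0 /andP[k0 kn]; have Npos : 0 < N%:R :> R by rewrite ltr0n.
pose H j := (binomial_tail_primitive R n.+1 k).[j%:R / N%:R].
have telH : \sum_(j < N) (H j.+1 - H j) = k%:R.
  rewrite -(big_mkord xpredT (fun j => H j.+1 - H j)) telescope_sumr // /H.
  rewrite divff ?gt_eqF // mul0r binomial_tail_primitive_0.
  by rewrite binomial_tail_primitive_1 ?subr0 // (leq_trans kn).
have incr (j : 'I_N) := @binomial_tail_primitive_increment R n k
  (j%:R / N%:R) (j.+1%:R / N%:R) k0.
have step (j : 'I_N) : j.+1%:R / N%:R - j%:R / N%:R = N%:R^-1 :> R.
  by rewrite -natr1; ring.
have main (j : 'I_N) :
    (binomial_tail R n.+1 k).[j.+1%:R / N%:R] <=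
      N%:R / n.+2%:R * (H j.+1 - H j) <=
    (binomial_tail R n.+1 k).[j%:R / N%:R].
  have x0 : 0 <= j%:R / N%:R :> R by rewrite divr_ge0.
  have xy : j%:R / N%:R <= j.+1%:R / N%:R :> R by rewrite -subr_ge0 step invr_ge0 ltW.
  have y1 : j.+1%:R / N%:R <= 1 :> R by rewrite ler_pdivrMr // mul1r ler_nat.
  have /andP[] := incr j x0 xy y1; rewrite step.
  rewrite -/(H j) -/(H j.+1).
  set G1 := (binomial_tail _ _ _).[_]; set G0 := (binomial_tail _ _ _).[_].
  have n2 : 0 < n.+2%:R :> R by rewrite ltr0n.
  have rescale (z : R) : z = N%:R / n.+2%:R * (z * N%:R^-1 * n.+2%:R).
    by field; rewrite !gt_eqF.
  move=> lo hi; apply/andP; split.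
    by rewrite [leLHS]rescale ler_wpM2l ?divr_ge0 ?ler0n.
  by rewrite [leRHS]rescale ler_wpM2l ?divr_ge0 ?ler0n.
have -> : N%:R * (k%:R / n.+2%:R) =
    \sum_(j < N) N%:R / n.+2%:R * (H j.+1 - H j) :> R.
  by rewrite -mulr_sumr telH; ring.
by apply/andP; split; apply: ler_sum => j _; have /andP[] := main j.
Qed.

(** * Counting independent events *)

Lemma probability_finite_partition (d : measure_display) (T : measurableType d)
    (R : realType) (P : probability T R) (J : finType) (h : T -> J)
    (p : pred J) (A : set T) :
  (forall j, measurable (h @^-1` [set j])) -> measurable A ->
  P ([set w | p (h w)] `&` A) = (\sum_(j | p j) P (h @^-1` [set j] `&` A))%E.
Proof.
move=> mh mA.
have -> : [set w | p (h w)] `&` A =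
    \bigcup_(j in [set` p]) (h @^-1` [set j] `&` A).
  apply/seteqP; split=> [w [/= pw Aw]|w [j /= pj [/= hj Aw]]].
    by exists (h w).
  by split => //=; rewrite hj.
rewrite measure_fin_bigcup //; last 2 first.
- by move=> i j _ _ [w [[/= <- _] [/= <- _]]].
- by move=> j _; exact: measurableI.
rewrite [RHS]bigfs // ?index_enum_uniq // => j _.
by rewrite mem_index_enum.
Qed.

Section counting.
Context (d : measure_display) (T : measurableType d) (R : realType)
  (P : probability T R) (m : nat).

Lemma measurable_hits (E : 'I_m -> set T) (J : {set 'I_m}) :
  (forall i, measurable (E i)) ->
  measurable ((fun w => [set i | w \in E i]%SET) @^-1` [set J]).
Proof.
move=> mE; have -> : (fun w => [set i | w \in E i]%SET) @^-1` [set J] =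
    \bigcap_(i in [set: 'I_m]) (if i \in J then E i else ~` E i).
  apply/seteqP; split=> [w /= <- i _|w /= EJ]; last first.
    apply/setP => i; rewrite inE; have := EJ i I.
    by case: ifPn => iJ Ei; [rewrite mem_set|rewrite memNset].
  rewrite inE; case: ifPn => [/set_mem //|/negP iE Ei]; exact/iE/mem_set.
apply: fin_bigcap_measurable => // i _.
by case: ifPn => _; [exact: mE|exact/measurableC].
Qed.

Lemma sum_subsets_card (f : nat -> R) (k : nat) :
  \sum_(J : {set 'I_m} | (#|J| < k)%N) f #|J| = \sum_(l < k) f l *+ 'C(m, l).
Proof.
have -> : \sum_(l < k) f l *+ 'C(m, l) =
    \sum_(l < k) \sum_(J : {set 'I_m} | #|J| == l) f l.
  apply: eq_bigr => l _; rewrite sumr_const; congr (_ *+ _).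
  by rewrite -[in LHS](card_ord m) -card_draws cardsE.
rewrite (exchange_big_dep (fun J : {set 'I_m} => (#|J| < k)%N)) /=; last first.
  by move=> l J _ /eqP ->.
apply: eq_bigr => J Jk; by rewrite (big_pred1 (Ordinal Jk)).
Qed.

(** The number of the first m scores in L is binomial(m, u) and independent of the last score. The
    event is split by the exact set J of indices whose scores fall in L. *)
Lemma independent_count (S : 'I_m.+1 -> {RV P >-> R}) (L Q : set R) (u : R)
    (k : nat) :
  mutually_independent S -> measurable L -> measurable Q ->
  (forall i : 'I_m, P (S (widen_ord (leqnSn m) i) @^-1` L) = u%:E) ->
  P ([set w | (#|[set i : 'I_m | S (widen_ord (leqnSn m) i) w \in L]%SET| < k)%N]
     `&` S ord_max @^-1` Q) =
  ((binomial_tail R m k).[u]%:E * P (S ord_max @^-1` Q))%E.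
Proof.
move=> indep mL mQ PL.
pose E (i : 'I_m) := S (widen_ord (leqnSn m) i) @^-1` L.
have mE i : measurable (E i) by exact: measurable_funPTI.
pose h w : {set 'I_m} := [set i | w \in E i]%SET.
have hE w : [set i : 'I_m | S (widen_ord (leqnSn m) i) w \in L]%SET = h w.
  apply/setP => i; rewrite !inE; apply/idP/idP => /set_mem ?; exact/mem_set.
under eq_set do rewrite hE.
rewrite (@probability_finite_partition _ _ _ P _ h (fun J => #|J| < k)%N);
  [|by move=> J; exact: measurable_hits|exact: measurable_funPTI].
have PJ (J : {set 'I_m}) : P (h @^-1` [set J] `&` S ord_max @^-1` Q) =
    ((u ^+ #|J| * (1 - u) ^+ (m - #|J|))%:E * P (S ord_max @^-1` Q))%E.
  (* One Borel set per index turns the event into a single intersection, to which mutual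
     independence applies. *)
  pose B (i : 'I_m.+1) := if unlift ord_max i is Some j
    then (if j \in J then L else ~` L) else Q.
  have Bw j : B (widen_ord (leqnSn m) j) = if j \in J then L else ~` L.
    rewrite /B (_ : widen_ord _ _ = lift ord_max j) ?liftK //.
    exact/val_inj/esym/lift_max.
  have Bm : B ord_max = Q by rewrite /B unlift_none.
  have mB i : measurable (B i).
    rewrite /B; case: unliftP => [j _|_ //].
    by case: ifP => _ //; exact: measurableC.
  have -> : h @^-1` [set J] `&` S ord_max @^-1` Q =
      \bigcap_(i in [set i | i \in [set: 'I_m.+1]%SET]) S i @^-1` B i.
    apply/seteqP; split=> [w [/= hJ Qw] i _|w Bw'].
      rewrite /B; case: unliftP => [j ->|->] //=.
      have -> : lift ord_max j = widen_ord (leqnSn m) j by exact/val_inj/lift_max.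
      rewrite -hJ inE; case: ifPn => [/set_mem //|/negP nE Lw].
      exact/nE/mem_set.
    have BwE i : B i (S i w) by apply: Bw'; rewrite /= finset.in_setT.
    split=> /=; last by rewrite -Bm.
    apply/setP => j; rewrite inE; have := BwE (widen_ord (leqnSn m) j).
    by rewrite Bw; case: ifPn => jJ Ej; [rewrite mem_set|rewrite memNset].
  rewrite indep //; under eq_bigl do rewrite finset.in_setT.
  rewrite big_ord_recr /= Bm; congr (_ * _)%E.
  rewrite (eq_bigr (fun j => (if j \in J then u else 1 - u)%:E)); last first.
    move=> j _; rewrite Bw; case: ifPn => _; first exact: PL.
    by rewrite preimage_setC probability_setC ?PL //; exact: measurable_funPTI.
  rewrite prodEFin (bigID (mem J)) /=; congr (_ * _)%:E.
    rewrite (eq_bigr (fun=> u)) => [|j ->//].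
    by rewrite prodr_const.
  rewrite (eq_bigr (fun=> 1 - u)) => [|j /negbTE ->//].
  rewrite prodr_const; congr (_ ^+ _).
  by rewrite -[X in (X - _)%N](card_ord m) -(cardC (mem J)) addKn.
under eq_bigr do rewrite PJ.
rewrite -(fineK (fin_num_measure P _ (measurable_funPTI (S ord_max) mQ))).
rewrite sumEFin -EFinM -mulr_suml; congr (_ * _)%:E.
rewrite (sum_subsets_card (fun l => u ^+ l * (1 - u) ^+ (m - l))) horner_sum.
by apply: eq_bigr => l _; rewrite hornerMn hornerM !hornerE.
Qed.
End counting.

(** * Continuous laws and the probability integral transform *)

Section continuous_law.
Context (d : measure_display) (T : measurableType d) (R : realType)
  (P : probability T R) (S : {RV P >-> R}).
Hypothesis S_cont : continuous_rv S.

Let F z := fine (cdf S z).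

Let F_fin z : cdf S z \is a fin_num.
Proof. exact: fin_num_measure. Qed.

Let F_nd x y : x <= y -> F x <= F y.
Proof. by move=> xy; rewrite fine_le //; exact: cdf_nondecreasing. Qed.

Let cdf_le_measure x A : measurable A -> (forall w, S w <= x -> A w) ->
  (cdf S x <= P A)%E.
Proof.
move=> mA xA; have := @le_measure _ _ _ P (S @^-1` `]-oo, x]) A.
by rewrite !inE; apply=> //; exact: measurable_funPTI.
Qed.

Let measure_le_cdf x A : measurable A -> (forall w, A w -> S w <= x) ->
  (P A <= cdf S x)%E.
Proof.
move=> mA xA; have := @le_measure _ _ _ P A (S @^-1` `]-oo, x]).
by rewrite !inE; apply=> //; exact: measurable_funPTI.
Qed.

Let F_continuous : continuous F.
Proof.
by move=> z; apply: fine_cvg; rewrite fineK //; exact: S_cont.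
Qed.

(** There are no atoms: F x <= P(S < z) for x < z, and x tends to z from the left. *)
Lemma strict_cdf_continuous z : strict_cdf S z = fine (cdf S z).
Proof.
have mS : measurable [set w | S w < z].
  rewrite (_ : [set w | S w < z] = S @^-1` `]-oo, z[).
    exact: measurable_funPTI.
  by apply/seteqP; split=> w /=; rewrite in_itv.
apply/eqP; rewrite eq_le; apply/andP; split.
  by rewrite fine_le ?fin_num_measure // measure_le_cdf // => w /= /ltW.
have FE : F x @[x --> z^'-] --> F z 
  by apply: cvg_at_left_filter; exact: F_continuous.
rewrite -/(F z) -(cvg_lim _ FE) //.
apply: limr_le; first by apply/cvg_ex; exists (F z).
near=> x; rewrite fine_le ?fin_num_measure //.
apply: cdf_le_measure => // w /= /le_lt_trans; apply.
by near: x; exact: nbhs_left_lt.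
Unshelve. all: by end_near. Qed.

Lemma cdf_quantile u : 0 < u < 1 -> exists z, fine (cdf S z) = u.
Proof.
move=> /andP[u0 u1].
have [a Fa] : exists a, F a < u.
  have : F x @[x --> -oo] --> (0 : R) by apply: fine_cvg; exact: cvg_cdfNy0.
  move/cvgr_lt => /(_ u u0) [a [_ /= aF]].
  by exists (a - 1); apply: aF; rewrite gtrBl.
have [b Fb] : exists b, u < F b.
  have : F x @[x --> +oo] --> (1 : R) by apply: fine_cvg; exact: cvg_cdfy1.
  move/cvgr_gt => /(_ u u1) [b [_ /= bF]].
  by exists (b + 1); apply: bF; rewrite ltrDl.
have ab : a <= b.
  rewrite leNgt; apply/negP => /ltW /F_nd ba.
  by move: (lt_le_trans Fb (le_trans ba (ltW Fa))); rewrite ltxx.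
have [|c _ Fc] := @IVT _ F a b u ab (continuous_subspaceT F_continuous).
  by rewrite ge_min (ltW Fa) le_max (ltW Fb) orbT.
by exists c.
Qed.

Lemma measurable_cdf_sublevel u : measurable [set z | strict_cdf S z <= u].
Proof.
rewrite (_ : [set z | _] = strict_cdf S @^-1` `]-oo, u]).
  exact: measurable_funPTI.
by apply/seteqP; split=> z /=; rewrite in_itv.
Qed.

(** F need not be strictly increasing, so each of the two bounds compares the event with S <= z for
    its own quantile z. *)
Lemma probability_integral_transform u : 0 <= u <= 1 ->
  P (S @^-1` [set z | strict_cdf S z <= u]) = u%:E.
Proof.
have mL v : measurable (S @^-1` [set z | strict_cdf S z <= v]).
  by apply: measurable_funPTI; exact: measurable_cdf_sublevel.
move=> /andP[u0 u1].
apply/eqP; rewrite eq_le; apply/andP; split.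
  have [->|u_lt1] := eqVneq u 1; first exact: probability_le1.
  have {u1 u_lt1} u1 : u < 1 by rewrite lt_neqAle u_lt1.
  apply/lee_addgt0Pr => e e0.
  (* F may be flat at level u, so a quantile of a slightly higher level is taken; the minimum keeps
     that level within e of u and below 1. *)
  have [|z Fz] := @cdf_quantile (u + Num.min e ((1 - u) / 2)).
    by case: (ltP e ((1 - u) / 2)) => *; apply/andP; split; lra.
  apply: (@le_trans _ _ (cdf S z)).
    apply: measure_le_cdf => // w /=; rewrite strict_cdf_continuous => Fw.
    rewrite leNgt; apply/negP => /ltW /F_nd; rewrite /F Fz.
    by move: Fw; rewrite /F; case: (ltP e ((1 - u) / 2)) => *; lra.
  by rewrite -(fineK (F_fin z)) Fz lee_fin lerD2l ge_min lexx.
(* The levels 0 and 1 may have no quantile, but there the bound is immediate. *)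
have [->|u_neq0] := eqVneq u 0; first exact: measure_ge0.
have [->|u_neq1] := eqVneq u 1.
  rewrite (_ : S @^-1` _ = setT) ?probability_setT //.
  apply/seteqP; split=> // w _ /=.
  by rewrite strict_cdf_continuous -lee_fin fineK // probability_le1.
have [|z Fz] := @cdf_quantile u.
  by rewrite !lt_neqAle eq_sym u_neq0 u_neq1 u0 u1.
rewrite -[X in (X%:E <= _)%E]Fz fineK // cdf_le_measure // => w /=.
by rewrite strict_cdf_continuous => /F_nd; rewrite /F Fz.
Qed.

End continuous_law.

(** * The uniform law, the Kolmogorov-Smirnov distance and the conformal rank *)

Lemma uniform_prob01_ray (R : realType) (t : R) : 0 <= t <= 1 ->
  uniform_prob (@ltr01 R) `]-oo, t] = t%:E.
Proof.
move=> /andP[t0 t1]; rewrite /uniform_prob integral_uniform_pdf.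
rewrite (_ : _ `&` _ = `[0, t]%classic); last first.
  apply/seteqP; split=> x /=; rewrite !in_itv /=; first by case=> -> /andP[->].
  by move=> /andP[-> xt]; rewrite xt (le_trans xt t1).
rewrite (eq_integral (cst 1%:E)); last first.
  move=> x; rewrite inE /= in_itv /= => /andP[x0 xt].
  by rewrite /uniform_pdf x0 (le_trans xt t1) subr0 invr1.
rewrite integral_cst //= mul1e lebesgue_measure_itv /= lte_fin.
case: ltP => [_|t_le0]; first by rewrite oppr0 adde0.
by have -> : t = 0 by apply/eqP; rewrite eq_le t0 t_le0.
Qed.

(** The bounds on [mu] and [nu] keep the differences at most 1, so the real [sup] is an upper
    bound. *)
Lemma dKS_upper_bound (R : realType) (mu nu : set R -> \bar R) (t : R) :
  (forall s, 0 <= mu `]-oo, s]%classic <= 1)%E ->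
  (forall s, 0 <= nu `]-oo, s]%classic <= 1)%E ->
  `|fine (mu `]-oo, t]%classic) - fine (nu `]-oo, t]%classic)| <= dKS mu nu.
Proof.
move=> mu01 nu01; apply: ub_le_sup; last by exists t.
have fine01 (x : \bar R) : (0 <= x <= 1)%E -> 0 <= fine x <= 1.
  by case: x => [r| |] //=; rewrite ?lexx ?ler01.
exists 1 => _ [s _ <-].
have /andP[m0 m1] := fine01 _ (mu01 s); have /andP[n0 n1] := fine01 _ (nu01 s).
by rewrite ler_norml; lra.
Qed.

(** Division by m + 1 of x <= ceil x < x + 1, where 0 < x <= m + 1. *)
Lemma conformal_rank_bounds (R : realType) (m : nat) (alpha : R) :
  0 < alpha -> alpha < 1 ->
  [/\ (0 < conformal_rank m alpha <= m.+1)%N,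
      1 - alpha <= (conformal_rank m alpha)%:R / m.+1%:R &
      (conformal_rank m alpha)%:R / m.+1%:R <= 1 - alpha + m.+1%:R^-1].
Proof.
move=> a0 a1; have m0 : 0 < m.+1%:R :> R by rewrite ltr0n.
set x : R := m.+1%:R * (1 - alpha).
have x0 : 0 < x by rewrite mulr_gt0 // subr_gt0.
have xm : x <= m.+1%:R by rewrite /x ger_pMr //; lra.
have c0 : 0 < Num.ceil x by rewrite ceil_gt0.
have kE : (conformal_rank m alpha)%:R = (Num.ceil x)%:~R :> R.
  by rewrite /conformal_rank -/x -[in RHS](gez0_abs (ltW c0)).
have /andP[lo hi] := ceil_itv x.
split.
- apply/andP; split; first by rewrite /conformal_rank -/x absz_gt0 gt_eqF.
  rewrite -(ler_nat R) kE -[leRHS]mulrz_nat ler_int ceil_le_int.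
  by rewrite mulrz_nat.
- by rewrite ler_pdivlMr // mulrC kE.
- rewrite ler_pdivrMr // mulrDl mulVf ?gt_eqF // kE mulrC -/x.
  by move: lo; rewrite intrB; lra.
Qed.

Lemma le_of_inv_nat (R : realType) (x y : R) :
  (forall N, (0 < N)%N -> x <= y + N%:R^-1) -> x <= y.
Proof.
move=> xy; apply/ler_addgt0Pr => e e0.
have ei : 0 <= e^-1 by rewrite invr_ge0 ltW.
have eN := archi_boundP ei; set N := Num.bound _ in eN.
have N0 : 0 < N%:R :> R by apply: le_lt_trans eN.
have := xy N; rewrite -(ltr0n R) => /(_ N0) /le_trans; apply.
by rewrite lerD2l invf_ple ?posrE // ltW.
Qed.

Lemma conformal_setE (R : realType) (XT YT : Type) (score : XT -> YT -> R)
    (m : nat) (s : 'I_m -> R) (alpha : R) (x : XT) (y : YT) :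
  0 < alpha -> alpha < 1 ->
  conformal_set score [seq s i | i <- enum 'I_m] alpha x y <->
  (#|[set i | (s i < score x y)%R]%SET| < conformal_rank m alpha)%N.
Proof.
move=> a0 a1; have [/andP[k0 _] _ _] := conformal_rank_bounds m a0 a1.
rewrite /conformal_set /= size_map size_enum_ord order_statE // count_map.
by rewrite cardsE cardE size_filter -enumT.
Qed.

(** * Coverage squeezed slice by slice *)

Section coverage.
Context (d : measure_display) (T : measurableType d) (R : realType)
  (P : probability T R) (m : nat) (S : 'I_m.+1 -> {RV P >-> R}) (k : nat).
Hypothesis S_indep : mutually_independent S.

Let W (i : 'I_m) := S (widen_ord (leqnSn m) i).

Definition coverage_event : set T :=
  [set w | (#|[set i | (W i w < S ord_max w)%R]%SET| < k)%N].

Lemma measurable_coverage_event : measurable coverage_event.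
Proof.
pose E i : set T := [set w | W i w < S ord_max w].
have mE i : measurable (E i).
  have := measurable_fun_ltr (measurable_funPT (W i))
    (measurable_funPT (S ord_max)).
  by move=> /(_ measurableT [set true] I); rewrite setTI.
pose h w : {set 'I_m} := [set i | w \in E i]%SET.
have -> : coverage_event =
    \bigcup_(J in [set J : {set 'I_m} | (#|J| < k)%N]) h @^-1` [set J].
  have hE w : h w = [set i | (W i w < S ord_max w)%R]%SET.
    apply/setP => i; rewrite !inE; apply/idP/idP => [/set_mem //|Ei].
    exact/mem_set.
  apply/seteqP; split=> [w Cw|w [J /= Jk hJ]].
    by exists (h w) => //=; rewrite hE.
  by rewrite /coverage_event /= -hE hJ.
by apply: fin_bigcup_measurable => // J _; exact: measurable_hits.
Qed.

Section slices.
Variables (L Q : set R) (u : R).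
Hypotheses (mL : measurable L) (mQ : measurable Q).
Hypothesis L_down : forall x y, x <= y -> L y -> L x.
Hypothesis PL : forall i : 'I_m, P (W i @^-1` L) = u%:E.

(** Unlike coverage, this event does not involve the last score, so its intersection with a slice
    factorizes. *)
Let few_below := [set w | (#|[set i | W i w \in L]%SET| < k)%N].

Let few_belowE : P (few_below `&` S ord_max @^-1` Q) =
  ((binomial_tail R m k).[u]%:E * P (S ord_max @^-1` Q))%E.
Proof. exact: independent_count. Qed.

Let measurable_few_below : measurable few_below.
Proof.
rewrite (_ : few_below =
    \bigcup_(J in [set J : {set 'I_m} | (#|J| < k)%N])
      (fun w => [set i | w \in W i @^-1` L]%SET) @^-1` [set J]).
  apply: fin_bigcup_measurable => // J _; apply: measurable_hits => i.
  exact: measurable_funPTI.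
have hE w : [set i | w \in W i @^-1` L]%SET = [set i | W i w \in L]%SET.
  by apply/setP => i; rewrite !inE; apply/idP/idP => /set_mem ?; exact/mem_set.
apply/seteqP; split=> [w Cw|w [J /= Jk hJ]].
  by exists [set i | W i w \in L]%SET => //=; rewrite hE.
by rewrite /few_below /= -hE hJ.
Qed.

Let measurable_slice : measurable (S ord_max @^-1` Q).
Proof. exact: measurable_funPTI. Qed.

(** If the last score lies in Q, hence in the down-closed L, so do all calibration scores below it:
    [few_below] implies coverage. *)
Lemma coverage_slice_ge : Q `<=` L ->
  (binomial_tail R m k).[u] * fine (P (S ord_max @^-1` Q)) <=
  fine (P (coverage_event `&` S ord_max @^-1` Q)).
Proof.
move=> QL; have mC := measurable_coverage_event.
rewrite -lee_fin EFinM !fineK ?fin_num_measure //; last exact: measurableI.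
rewrite -few_belowE le_measure ?inE //; [exact: measurableI..|].
move=> w [/= fw Qw]; split=> //; apply: leq_ltn_trans fw.
apply/subset_leq_card/fintype.subsetP => i; rewrite !inE => iw.
exact/(L_down (ltW iw))/QL.
Qed.

(** A calibration score in L is below the last one, which would otherwise lie in L by down-closure:
    coverage implies [few_below]. *)
Lemma coverage_slice_le : Q `&` L = set0 ->
  fine (P (coverage_event `&` S ord_max @^-1` Q)) <=
  (binomial_tail R m k).[u] * fine (P (S ord_max @^-1` Q)).
Proof.
move=> QL; have mC := measurable_coverage_event.
rewrite -lee_fin EFinM !fineK ?fin_num_measure //; last exact: measurableI.
rewrite -few_belowE le_measure ?inE //; [exact: measurableI..|].
move=> w [/= fw Qw]; split=> //; apply: leq_ltn_trans fw.
apply/subset_leq_card/fintype.subsetP => i; rewrite !inE => iw.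
rewrite ltNge; apply/negP => wi.
have : (Q `&` L) (S ord_max w) by split=> //; exact: L_down iw.
by rewrite QL.
Qed.

End slices.

Hypothesis S_cont : forall i, continuous_rv (S i).
Hypothesis S_ident : forall i j : 'I_m.+1, (i < m)%N -> (j < m)%N ->
  same_law (S i) (S j).
Hypothesis km : (0 < k <= m)%N.

Let D := dKS (distribution P (strict_cdf (S ord0) \o S ord_max))
             (uniform_prob (@ltr01 R)).

(** On the grid j / N, [V] samples the distribution function of F0(R_{m+1}) and [G] the binomial
    tail. *)
Let level N j : set R := [set z | strict_cdf (S ord0) z <= j%:R / N%:R].
Let V N j : R := fine (P (S ord_max @^-1` level N j)).
Let G N j : R := (binomial_tail R m k).[j%:R / N%:R].

Let measurable_level N j : measurable (level N j).
Proof. exact: measurable_cdf_sublevel. Qed.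

Let level_down N j x y : x <= y -> level N j y -> level N j x.
Proof.
move=> xy; apply: le_trans.
rewrite !strict_cdf_continuous // fine_le ?fin_num_measure //.
exact: cdf_nondecreasing.
Qed.

Let grid01 N j : (j <= N)%N -> 0 <= (j%:R / N%:R : R) <= 1.
Proof.
(* For N = 0 the quotient is 0, by the convention for the inverse of 0. *)
move=> jN; rewrite divr_ge0 //=; case: N jN => [|N] jN.
  by rewrite invr0 mulr0.
by rewrite ler_pdivrMr ?ltr0n // mul1r ler_nat.
Qed.

Let level_mono N j : level N j `<=` level N j.+1.
Proof.
by move=> x /le_trans; apply; rewrite ler_wpM2r ?invr_ge0 // ler_nat.
Qed.

Let P_level N j : (j <= N)%N ->
  forall i, P (W i @^-1` level N j) = (j%:R / N%:R)%:E.
Proof.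
(* [S ord0] is a calibration score only if m > 0, which the index i guarantees. *)
move=> jN i; have m0 : (@ord0 m < m)%N by exact: leq_ltn_trans (ltn_ord i).
rewrite -(@probability_integral_transform _ _ _ P (S ord0)) ?grid01 //.
by apply: (S_ident _ m0) => //=; exact: ltn_ord.
Qed.

Let V_near_uniform N j : (j <= N)%N -> `|V N j - j%:R / N%:R| <= D.
Proof.
move=> jN; have j01 := grid01 jN.
have := @dKS_upper_bound R (distribution P (strict_cdf (S ord0) \o S ord_max))
  (uniform_prob (@ltr01 R)) (j%:R / N%:R).
rewrite uniform_prob01_ray //= => bound.
have -> : V N j = fine (distribution P (strict_cdf (S ord0) \o S ord_max)
    `]-oo, (j%:R / N%:R)]%classic).
  congr (fine (P _)); apply/seteqP; split=> w /=; by rewrite in_itv.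
by apply: bound => s; rewrite measure_ge0 probability_le1.
Qed.

(** Induction on n adds one slice at a time, starting from the mass [V N 0] of F0(R_{m+1}) <= 0,
    where the factor G(0) is 1. *)
Let slices N n : (0 < N)%N -> (n <= N)%N ->
  \sum_(j < n) (V N j.+1 - V N j) * G N j.+1 + V N 0 <=
    fine (P (coverage_event `&` S ord_max @^-1` level N n)) <=
  \sum_(j < n) (V N j.+1 - V N j) * G N j + V N 0.
Proof.
move=> N0; have mC := measurable_coverage_event.
have mV j : measurable (S ord_max @^-1` level N j).
  by apply: measurable_funPTI; exact: measurable_level.
elim: n => [_|n IH nN].
  rewrite !big_ord0 !add0r; apply/andP; split.
    have /= := @coverage_slice_ge (level N 0) (level N 0) _
      (measurable_level N 0) (measurable_level N 0) (@level_down N 0)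
      (P_level (leq0n N)) (@subset_refl _ _).
    have [k' ->] : exists k', k = k'.+1 by case: k km => // k'; exists k'.
    by rewrite mul0r binomial_tail_0 mul1r.
  rewrite fine_le ?fin_num_measure //; first exact: measurableI.
  by rewrite le_measure ?inE //; exact: measurableI.
pose Q := level N n.+1 `\` level N n.
pose A j := S ord_max @^-1` level N j.
have SQ : S ord_max @^-1` Q = A n.+1 `\` A n by [].
have A_mono : A n `<=` A n.+1 by move=> w; exact: level_mono.
have mQ : measurable Q by exact: measurableD.
have VQ : V N n.+1 - V N n = fine (P (S ord_max @^-1` Q)).
  rewrite SQ measureD; [|exact: mV|exact: mV|].
    by rewrite setIidr // fineB ?fin_num_measure //; exact: mV.
  by rewrite -ge0_fin_numE ?fin_num_measure //; exact: mV.
have -> : fine (P (coverage_event `&` S ord_max @^-1` level N n.+1)) =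
    fine (P (coverage_event `&` S ord_max @^-1` level N n)) +
    fine (P (coverage_event `&` S ord_max @^-1` Q)).
  have mSQ : measurable (S ord_max @^-1` Q) by exact: measurable_funPTI.
  rewrite -fineD ?fin_num_measure //; try exact: measurableI.
  rewrite -measureU; try exact: measurableI.
    by rewrite SQ -setIUr setDE setUIr setUCr setIT (setUidr A_mono).
  by apply/seteqP; split=> // w [[_ Aw] [_ [_ nAw]]].
have /andP[IHlo IHhi] := IH (ltnW nN).
(* The slice Q lies inside [level N n.+1] and is disjoint from [level N n]: these two levels give
   the lower and the upper bound. *)
have lo : (V N n.+1 - V N n) * G N n.+1 <=
    fine (P (coverage_event `&` S ord_max @^-1` Q)).
  rewrite VQ mulrC; apply: (@coverage_slice_ge (level N n.+1)) => //.
  - exact: level_down.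
  - exact: P_level.
  - by move=> x [].
have hi : fine (P (coverage_event `&` S ord_max @^-1` Q)) <=
    (V N n.+1 - V N n) * G N n.
  rewrite VQ mulrC; apply: (@coverage_slice_le (level N n)) => //.
  - exact: level_down.
  - exact/P_level/ltnW.
  - by rewrite /Q setDE setIAC -setIA setICr setI0.
by rewrite !big_ord_recr /=; apply/andP; split; lra.
Qed.

Lemma coverage_bounds :
  k%:R / m.+1%:R - D <= fine (P coverage_event) <= k%:R / m.+1%:R + D.
Proof.
have [k0 kn] := andP km.
(* The polynomial estimates have degree n + 1; with n = m - 1 their integral k / (n + 2) is k / (m +
   1). *)
have mE : m = m.-1.+1 by case: m km => [|//]; case: k k0.
have main N : (0 < N)%N ->
    fine (P coverage_event) <= k%:R / m.+1%:R + D + N%:R^-1 /\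
    k%:R / m.+1%:R - D - N%:R^-1 <= fine (P coverage_event).
  move=> N0; have /andP[lo hi] := slices N0 (leqnn N).
  have levelN : level N N = setT.
    apply/seteqP; split=> // z _; rewrite /level /= divff ?pnatr_eq0 -?lt0n //.
    by rewrite strict_cdf_continuous // -lee_fin fineK ?fin_num_measure ?cdf_le1.
  rewrite levelN preimage_setT setIT in lo hi.
  have Gd j : (j < N)%N -> G N j.+1 <= G N j.
    move=> jN; rewrite /G mE; have /andP[_ x1] := grid01 jN.
    apply: binomial_tail_nonincreasing => //.
    by rewrite ler_wpM2r ?invr_ge0 // ler_nat.
  have G0 : G N 0 = 1.
    by rewrite /G mul0r; case: k k0 => // k' _; rewrite binomial_tail_0.
  have GN : G N N = 0.
    by rewrite /G divff ?pnatr_eq0 -?lt0n // binomial_tail_1.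
  have := @binomial_tail_Riemann_sums R m.-1 k N N0; rewrite -mE km => /(_ isT) RS.
  have [up down] := step_sums_bounds N0 (@V_near_uniform N) Gd G0 GN RS.
  by split; [exact: le_trans hi up|exact: le_trans down lo].
apply/andP; split; apply: le_of_inv_nat => N /main[]; last by [].
by move=> _; rewrite lerBlDr.
Qed.

End coverage.

Theorem corollary6 (R : realType) (d : measure_display) (T : measurableType d)
    (P : probability T R) (XT YT : Type) (m : nat)
    (X : 'I_m.+1 -> T -> XT) (Y : 'I_m.+1 -> T -> YT)
    (score : XT -> YT -> R) (score_ge0 : forall x y, 0 <= score x y)
    (S : 'I_m.+1 -> {RV P >-> R})
    (S_score : forall i w, S i w = score (X i w) (Y i w))
    (S_indep : mutually_independent S)
    (S_cont : forall i, continuous_rv (S i))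
    (S_ident : forall i j : 'I_m.+1, (i < m)%N -> (j < m)%N ->
       same_law (S i) (S j))
    (alpha : R) (alpha_gt0 : 0 < alpha) (alpha_lt1 : alpha < 1) :
  let calib (w : T) : seq R :=
    [seq S (widen_ord (leqnSn m) i) w | i <- enum 'I_m] in
  let D : R := dKS (distribution P (strict_cdf (S ord0) \o S ord_max))
                   (uniform_prob (@ltr01 R)) in
  let coverage : \bar R :=
    P [set w | conformal_set score (calib w) alpha (X ord_max w)
                 (Y ord_max w)] in
  ((- D)%:E <= coverage - (1 - alpha)%:E)%E /\
  (coverage - (1 - alpha)%:E <= (m.+1%:R^-1 + D)%:E)%E.
Proof.
move=> calib D coverage.
set k := conformal_rank m alpha.
have [/andP[k0 km] klo khi] := conformal_rank_bounds m alpha_gt0 alpha_lt1.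
have setE : [set w | conformal_set score (calib w) alpha (X ord_max w)
    (Y ord_max w)] = coverage_event S k.
  by apply/seteqP; split=> w /=; rewrite conformal_setE // -S_score.
have mC := measurable_coverage_event S k.
have -> : coverage = (fine (P (coverage_event S k)))%:E.
  by rewrite /coverage setE fineK ?fin_num_measure.
rewrite -EFinB !lee_fin.
have [k_le_m|m_lt_k] := leqP k m.
  have := coverage_bounds S_indep S_cont S_ident (introT andP (conj k0 k_le_m)).
  rewrite -/k -/D => /andP[lo hi]; rewrite -/k in klo khi.
  set q := _ / _ in lo hi klo khi; set r := _^-1 in khi *.
  by split; lra.
(* In the remaining case k = m + 1, D is nonnegative because it dominates the deviation at the point
   0. *)
have D0 : 0 <= D.
  have := @dKS_upper_bound R (distribution P (strict_cdf (S ord0) \o S ord_max))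
    (uniform_prob (@ltr01 R)) 0.
  move=> bound; apply: le_trans (bound _ _) => // s.
    by rewrite measure_ge0 probability_le1.
  by rewrite measure_ge0 probability_le1.
(* Only m calibration scores exist, so fewer than k of them lie below the last one. *)
have -> : coverage_event S k = setT.
  apply/seteqP; split=> // w _; rewrite /coverage_event /=.
  by rewrite (leq_ltn_trans (max_card _)) // card_ord.
have kE : k = m.+1 by apply/eqP; rewrite eqn_leq km.
(* For k = m + 1 the bound [khi] gives alpha <= 1 / (m + 1), as coverage 1 demands. *)
rewrite probability_setT /=; move: khi; rewrite -/k kE divff ?pnatr_eq0 // => khi.
set r := _^-1 in khi *.
by split; lra.
Qed.
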